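(* For $n\ge 6$, with $T(n)$ and $L(n)$ as in the context, the number of non-empty cells in the left leaves (leaves that are left children) of $T(n)$ equals $L(n-L(n-2))$, and the number of non-empty cells in the right leaves of $T(n)$ equals $L(n-3-L(n-5))$. Hence $L(n)=L(n-L(n-2))+L(n-3-L(n-5))$.
   Context: Let $T$ be the following infinite binary tree, all of whose leaves lie on a single bottom level. There is a sequence of ''s-nodes'' $S_1,S_2,\dots$: $S_1$ has two children, both leaves; for $m\ge 2$, $S_m$ has left child $S_{m-1}$ and right child the root of a complete binary tree of the same height as the subtree rooted at $S_{m-1}$ (so the subtree rooted at each $S_m$ is a complete binary tree with all leaves on the bottom level). Nodes on the bottom level are leaves; each leaf has two cells (a left cell and a right cell). Nodes that are neither leaves nor s-nodes are regular nodes. For $n\ge0$, $T(n)$ is $T$ with labels $1,2,\dots,n$ inserted in preorder starting from the leftmost leaf (i.e. traversing the two leaf children of $S_1$, then the right subtree of $S_2$ in preorder, then the right subtree of $S_3$, etc.): s-nodes receive no label, each regular node receives one label, and each leaf receives three consecutive labels, the first in its left cell and the next two in its right cell (the last node reached may be only partially labelled). A cell is non-empty if it contains at least one label. $L(n)$ is the number of non-empty cells in $T(n)$. *)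

(* Defs.v *)
From mathcomp Require Import all_boot.
Set Implicit Arguments.
Unset Strict Implicit.
Unset Printing Implicit Defensive.

(* The infinite tree T has no root, so a node is given by its height above the
   bottom level and its rank, counted from 0, from the left among the nodes of
   that height.  Every pair is a node of T; the leaves are the nodes of height
   0. *)
Definition node := (nat * nat)%type.
Definition height (v : node) : nat := v.1.
Definition rank (v : node) : nat := v.2.

(* The children are meaningful only for nodes of positive height. *)
Definition lchild (v : node) : node := ((height v).-1, (rank v).*2).
Definition rchild (v : node) : node := ((height v).-1, (rank v).*2.+1).
Definition parent (v : node) : node := ((height v).+1, (rank v)./2).

Definition is_lchild (v : node) : bool := v == lchild (parent v).
Definition is_rchild (v : node) : bool := v == rchild (parent v).

(* S_m for m >= 1; for m = 0 this is the leftmost leaf, the left child of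
   S_1. *)
Definition snode (m : nat) : node := (m, 0).

Definition is_leaf (v : node) : bool := height v == 0.
Definition is_snode (v : node) : bool := (0 < height v) && (v == snode (height v)).

Lemma lchild_snode m : lchild (snode m.+1) = snode m.
Proof. by []. Qed.

Lemma is_lchildP v :
  reflect (exists2 u, ~~ is_leaf u & v = lchild u) (is_lchild v).
Proof.
apply: (iffP eqP) => [->|[[[|h] k] // _ ->]]; first by exists (parent v).
by rewrite /lchild /parent /= doubleK.
Qed.

Lemma is_rchildP v :
  reflect (exists2 u, ~~ is_leaf u & v = rchild u) (is_rchild v).
Proof.
apply: (iffP eqP) => [->|[[[|h] k] // _ ->]]; first by exists (parent v).
by rewrite /rchild /parent /= uphalf_double.
Qed.

(* Preorder traversal of the first h + 1 levels of the subtree rooted at v. *)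
Fixpoint preorder_rec (h : nat) (v : node) : seq node :=
  v :: (if h is h'.+1
        then preorder_rec h' (lchild v) ++ preorder_rec h' (rchild v)
        else [::]).

Definition preorder (v : node) : seq node := preorder_rec (height v) v.

(* The part of the traversal of T, started from the leftmost leaf, that lies in
   the subtree rooted at S_m: the leftmost leaf, then the right subtrees of
   S_1, ..., S_m.  The s-nodes are passed over. *)
Fixpoint traversal (m : nat) : seq node :=
  if m is m'.+1 then traversal m' ++ preorder (rchild (snode m))
  else [:: snode 0].

(* A cell is a leaf together with a side: false for the left cell, true for the
   right cell.  A label is placed either at a node or in a cell. *)
Definition cell := (node * bool)%type.
Definition place := (node + cell)%type.

(* The places that one visit of v offers to successive labels. *)
Definition slots (v : node) : seq place :=
  if is_leaf v then [:: inr (v, false); inr (v, true); inr (v, true)]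
  else if is_snode v then [::] else [:: inl v].

Definition slot_seq (m : nat) : seq place := flatten (map slots (traversal m)).

(* The place of label i >= 1, in every T(n) with i <= n.  The subtree rooted at
   S_i is large enough to receive it, and by [place_of_stable] any larger
   subtree gives the same place. *)
Definition place_of (i : nat) : place :=
  nth (inl (snode 0)) (slot_seq i) i.-1.

Lemma slot_seqS m :
  slot_seq m.+1 = slot_seq m ++ flatten (map slots (preorder (rchild (snode m.+1)))).
Proof. by rewrite /slot_seq /= map_cat flatten_cat. Qed.

Lemma size_slot_seq m : m < size (slot_seq m).
Proof.
elim: m => // m IHm; rewrite slot_seqS size_cat -[m.+2]addn1.
apply: leq_add IHm _; case: m => // m.
by rewrite /preorder /= /slots /is_snode xpair_eqE !andbF.
Qed.

Lemma place_of_stable x0 i m :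
  0 < i -> i <= m -> nth x0 (slot_seq m) i.-1 = place_of i.
Proof.
move=> i_gt0 /subnKC<-; elim: (m - i) => [|d IHd].
  by rewrite addn0; apply: set_nth_default; apply: leq_ltn_trans (leq_pred i) (size_slot_seq i).
rewrite addnS slot_seqS nth_cat IHd ifT //.
apply: leq_ltn_trans (leq_pred i) (leq_ltn_trans (leq_addr d i) (size_slot_seq _)).
Qed.

(* T(n), as the function giving the labels at each place. *)
Definition T (n : nat) (p : place) : seq nat :=
  [seq i <- iota 1 n | place_of i == p].

Definition nonempty (n : nat) (c : cell) : bool := T n (inr c) != [::].

Definition get_cell (p : place) : option cell :=
  if p is inr c then Some c else None.

(* The list, without repetition, of the non-empty cells of T(n); see
   [mem_nonempty_cells]. *)
Definition nonempty_cells (n : nat) : seq cell :=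
  undup (pmap (get_cell \o place_of) (iota 1 n)).

Lemma nonempty_cells_uniq n : uniq (nonempty_cells n).
Proof. exact: undup_uniq. Qed.

Lemma mem_nonempty_cells n c : (c \in nonempty_cells n) = nonempty n c.
Proof.
rewrite mem_undup mem_pmap /nonempty /T -has_filter.
apply/mapP/hasP => [[i i_n /= ci]|[i i_n /eqP ci]]; exists i => //=; last by rewrite ci.
by case: (place_of i) ci => //= d [->].
Qed.

Definition L (n : nat) : nat := size (nonempty_cells n).

Definition L_left (n : nat) : nat :=
  count (fun c : cell => is_lchild c.1) (nonempty_cells n).
Definition L_right (n : nat) : nat :=
  count (fun c : cell => is_rchild c.1) (nonempty_cells n).

(* In particular n - L (n - 2) and n - 3 - L (n - 5) are never truncated when
   n >= 6. *)
Lemma L_le n : L n <= n.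
Proof.
apply: leq_trans (size_undup _) _.
by rewrite size_pmap -{2}(size_iota 1 n) -(size_map (get_cell \o place_of)) size_map count_size.
Qed.

(* Main.v *)
Require Import Defs.
From mathcomp Require Import all_boot.
From mathcomp Require Import zify.

(* Let [pos k] be the number of labels placed before the [k]-th leaf.  The
   regular nodes met between leaves k - 1 and k are the ancestors of leaf k for
   which it is the leftmost descendant, and there are v_2(k) of them.  Hence
   pos (k + 1) = pos k + 3 + v_2(k + 1), which gives pos (2k) = pos k + 4k.
   The cell b of leaf k is non-empty in T(n) iff pos k + b < n, so all counts
   are sums over leaves.  Since L takes the value 4j just below pos (2j), and
   n - L(n - 2) is nondecreasing in n, this yields
   pos (2j) + b < n iff pos j + b < n - L (n - 2),
   which is the identity for left leaves.  As pos (2j + 1) = pos (2j) + 3, the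
   right leaves of T(n) are filled like the left leaves of T(n - 3). *)

(** * Arithmetic of the leaf positions *)

Fixpoint pos (k : nat) : nat :=
  if k is k'.+1 then pos k' + 3 + logn 2 k else 0.

Arguments pos : simpl never.

Lemma posS k : pos k.+1 = pos k + 3 + logn 2 k.+1.
Proof. by []. Qed.

Lemma logn2_odd k : logn 2 k.*2.+1 = 0.
Proof. by rewrite lognE dvdn2 /= odd_double. Qed.

Lemma logn2_double k : logn 2 k.+1.*2 = (logn 2 k.+1).+1.
Proof. by rewrite -mul2n lognM //= addnC addn1. Qed.

Lemma pos_double k : pos k.*2 = pos k + 4 * k.
Proof.
elim: k => // k IHk; rewrite doubleS posS posS IHk logn2_odd -doubleS.
rewrite logn2_double posS; lia.
Qed.

Lemma pos_doubleS k : pos k.*2.+1 = pos k.*2 + 3.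
Proof. by rewrite posS logn2_odd addn0. Qed.

Lemma pos_leq i k : i <= k -> pos i + 3 * (k - i) <= pos k.
Proof.
elim: k => [|k IHk]; first by case: i.
rewrite leq_eqVlt => /predU1P[->|]; first by rewrite subnn addn0.
rewrite ltnS => le_ik; have := IHk le_ik; rewrite posS; lia.
Qed.

(** * The label sequence cut into one block per leaf *)

Definition leaf_cell (k : nat) (b : bool) : cell := ((0, k), b).

(* The cells receiving the labels from the one following leaf k - 1 up to the
   last one of leaf k; None stands for a label at a regular node. *)
Definition block (k : nat) : seq (option cell) :=
  nseq (logn 2 k) None ++
  [:: Some (leaf_cell k false); Some (leaf_cell k true); Some (leaf_cell k true)].

Definition blocks (i m : nat) : seq (option cell) :=
  flatten (map block (iota i m)).

Lemma blocksD i m1 m2 : blocks i (m1 + m2) = blocks i m1 ++ blocks (i + m1) m2.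
Proof. by rewrite /blocks iotaD map_cat flatten_cat. Qed.

(** The leftmost leaf below [(h, k)] is also leftmost below [logn 2 k] regular nodes strictly above
    [(h, k)]. Prepending these completes the first block, which lets the induction run; [0 < k]
    rules out s-nodes. *)
Lemma slots_preorder h k :
  0 < k ->
  nseq (logn 2 k) None ++ map get_cell (flatten (map slots (preorder_rec h (h, k))))
  = blocks (k * 2 ^ h) (2 ^ h).
Proof.
elim: h k => [|h IHh] k k_gt0; first by rewrite muln1 /blocks /= cats0.
have -> : flatten (map slots (preorder_rec h.+1 (h.+1, k))) =
    inl (h.+1, k) :: flatten (map slots (preorder_rec h (h, k.*2)))
      ++ flatten (map slots (preorder_rec h (h, k.*2.+1))).
  rewrite /= map_cat flatten_cat /slots /= /is_snode /snode xpair_eqE eqxx.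
  by case: k k_gt0.
have -> : 2 ^ h.+1 = 2 ^ h + 2 ^ h by rewrite expnS mul2n addnn.
rewrite blocksD.
have -> : k * (2 ^ h + 2 ^ h) = k.*2 * 2 ^ h by rewrite addnn -!mul2n; lia.
rewrite -mulSnr -!IHh ?double_gt0 // logn2_odd /= map_cat.
case: k k_gt0 => // k _; rewrite logn2_double -[(logn 2 _).+1]addn1 nseqD -!catA.
by [].
Qed.

Lemma map_get_cell_slot_seq m : map get_cell (slot_seq m) = blocks 0 (2 ^ m).
Proof.
elim: m => // m IHm; rewrite slot_seqS map_cat IHm.
have := @slots_preorder m 1 isT; rewrite logn1 mul1n /= => ->.
by rewrite expnS mul2n -addnn blocksD add0n.
Qed.

Lemma map_place_of n : map place_of (iota 1 n) = take n (slot_seq n).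
Proof.
have sz : size (take n (slot_seq n)) = n.
  by rewrite size_takel // ltnW // size_slot_seq.
apply: (@eq_from_nth _ (inl (snode 0))) => [|i]; rewrite size_map size_iota ?sz //.
move=> lt_in; rewrite (nth_map 0) ?size_iota // nth_iota // nth_take //.
by rewrite -(@place_of_stable (inl (snode 0)) (1 + i) n).
Qed.

(** The regular nodes opening block [m] also precede leaf [m], hence the extra term. *)
Lemma size_blocks m : size (blocks 0 m) + logn 2 m = pos m.
Proof.
elim: m => // m IHm; rewrite -{1}[m.+1]addn1 blocksD size_cat.
rewrite {2}/blocks /= cats0 size_cat size_nseq /= posS -IHm.
move: (size _) (logn _ _) (logn _ _); lia.
Qed.

Lemma mem_block c k : (Some c \in block k) = (c.1 == (0, k)).
Proof.
rewrite mem_cat mem_nseq andbF !inE /=; case: c => v b.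
rewrite !(inj_eq (@Some_inj _)) !xpair_eqE /=.
by case: b; rewrite ?andbT ?andbF ?orbF ?orbb.
Qed.

Lemma mem_blocks c m : (Some c \in blocks 0 m) = (c.1.1 == 0) && (c.1.2 < m).
Proof.
elim: m => [|m IHm]; first by rewrite andbF.
rewrite -addn1 blocksD mem_cat IHm /blocks /= cats0 mem_block addn1 ltnS.
by case: c {IHm} => [[h k] b] /=; rewrite xpair_eqE -andb_orr orbC -leq_eqVlt.
Qed.

Lemma index_block k b :
  index (Some (leaf_cell k b)) (block k) = logn 2 k + b.
Proof.
rewrite index_cat mem_nseq andbF size_nseq /=.
by rewrite !(inj_eq (@Some_inj _)) !xpair_eqE !eqxx /=; case: b.
Qed.

Lemma index_blocks k b m :
  k < m -> index (Some (leaf_cell k b)) (blocks 0 m) = pos k + b.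
Proof.
elim: m => // m IHm; rewrite ltnS -addn1 blocksD index_cat mem_blocks /=.
rewrite leq_eqVlt; case: ltnP => [lt_km _|_]; first exact: IHm.
rewrite orbF => /eqP <-; rewrite /blocks /= cats0 index_block.
by rewrite addnA -/(blocks 0 k) size_blocks.
Qed.

Lemma nonempty_cell n c :
  (c \in nonempty_cells n) = (c.1.1 == 0) && (pos c.1.2 + c.2 < n).
Proof.
rewrite mem_undup mem_pmap map_comp map_place_of map_take map_get_cell_slot_seq.
case: c => [[h k] b] /=; have [le_kn|lt_nk] := ltnP k (2 ^ n).
  have [->|h_neq0] := eqVneq h 0; last first.
    apply: contraNF h_neq0 => /mem_take; by rewrite mem_blocks => /andP[].
  by rewrite in_take ?mem_blocks // (@index_blocks k b).
(* Such a leaf lies beyond the blocks considered, and [pos k >= 3 * k] already exceeds [n]. *)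
have -> : (pos k + b < n) = false.
  have := @pos_leq 0 k isT; have := ltn_expl n (ltnSn 1); lia.
rewrite andbF; apply: contraTF lt_nk => /mem_take; rewrite mem_blocks -ltnNge.
by case/andP.
Qed.

(** * Counts of cells as sums over leaves *)

Lemma count_nonempty_cells (P : pred nat) n M :
  n <= M ->
  count (fun c : cell => P c.1.2) (nonempty_cells n)
  = \sum_(0 <= k < M | P k) ((pos k < n) + (pos k + 1 < n)).
Proof.
move=> le_nM; pose s := [seq leaf_cell k b | k <- iota 0 M, b <- [:: false; true]].
have s_uniq : uniq s by apply: allpairs_uniq; rewrite ?iota_uniq // => -[i a] [j b] _ _ [-> ->].
have /permP-> : perm_eq (nonempty_cells n) [seq c : cell <- s | pos c.1.2 + c.2 < n].
  apply: uniq_perm; rewrite ?filter_uniq ?nonempty_cells_uniq // => c.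
  rewrite nonempty_cell mem_filter andbC.
  case: (ltnP _ n) => //= lt_n; symmetry; case: c lt_n => [[h k] b] /= lt_n.
  apply/allpairsP/eqP => [[[i a] [_ _ [-> _ _]]] //|->].
  exists (k, b); rewrite mem_iota /=; split=> //; last by case: b {lt_n}.
  have := @pos_leq 0 k isT; lia.
rewrite count_filter /s -sum1_count big_mkcond big_allpairs_dep /= /index_iota subn0.
rewrite [RHS]big_mkcond; apply: eq_bigr => k _; rewrite !big_cons big_nil /= addn0.
by case: (P k); rewrite //= addn0; do 2!case: ltnP.
Qed.

Lemma L_sum n M :
  n <= M -> L n = \sum_(0 <= k < M) ((pos k < n) + (pos k + 1 < n)).
Proof.
by move=> le_nM; rewrite /L -count_predT (@count_nonempty_cells predT n M).
Qed.

Lemma sum_even_odd (F : nat -> nat) M :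
  (\sum_(0 <= k < M.*2 | ~~ odd k) F k = \sum_(0 <= j < M) F j.*2) *
  (\sum_(0 <= k < M.*2 | odd k) F k = \sum_(0 <= j < M) F j.*2.+1).
Proof.
elim: M => [|M [IHe IHo]]; first by rewrite !big_geq.
rewrite doubleS; split.
  rewrite big_mkcond !big_nat_recr //= -big_mkcond IHe odd_double /=; lia.
rewrite big_mkcond !big_nat_recr //= -big_mkcond IHo odd_double /=; lia.
Qed.

Lemma is_lchild_leaf n c :
  c \in nonempty_cells n -> is_lchild c.1 = ~~ odd c.1.2.
Proof.
rewrite nonempty_cell; case: c => [[h k] b] /= /andP[/eqP-> _].
by rewrite /is_lchild xpair_eqE /=; lia.
Qed.

Lemma is_rchild_leaf n c :
  c \in nonempty_cells n -> is_rchild c.1 = odd c.1.2.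
Proof.
rewrite nonempty_cell; case: c => [[h k] b] /= /andP[/eqP-> _].
by rewrite /is_rchild xpair_eqE /=; lia.
Qed.

Lemma L_left_sum n M :
  n <= M -> L_left n = \sum_(0 <= j < M) ((pos j.*2 < n) + (pos j.*2 + 1 < n)).
Proof.
move=> le_nM; rewrite /L_left (eq_in_count (@is_lchild_leaf n)).
rewrite (@count_nonempty_cells (fun k => ~~ odd k) n M.*2); last by lia.
by rewrite sum_even_odd.
Qed.

Lemma L_right_sum n M :
  n <= M ->
  L_right n = \sum_(0 <= j < M) ((pos j.*2.+1 < n) + (pos j.*2.+1 + 1 < n)).
Proof.
move=> le_nM; rewrite /L_right (eq_in_count (@is_rchild_leaf n)).
rewrite (@count_nonempty_cells odd n M.*2); last by lia.
by rewrite sum_even_odd.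
Qed.

Lemma L_right_left n : L_right n = L_left (n - 3).
Proof.
rewrite (@L_right_sum n n) // (@L_left_sum (n - 3) n) ?leq_subr //.
by apply: eq_bigr => j _; rewrite pos_doubleS; congr (nat_of_bool _ + nat_of_bool _); lia.
Qed.

Lemma L_split n : L n = L_left n + L_right n.
Proof.
rewrite /L_left (eq_in_count (@is_lchild_leaf n)) /L_right (eq_in_count (@is_rchild_leaf n)).
by rewrite addnC /L -(count_predC (fun c : cell => odd c.1.2)).
Qed.

(** * Values and growth of [L], and the recurrence *)

Lemma L_between k n : pos k + 1 < n -> n <= pos k.+1 -> L n = 2 * k.+1.
Proof.
move=> gt_n le_n; have le_nM : n <= k.+1 + n by lia.
rewrite (L_sum _ _ le_nM) (big_cat_nat (n := k.+1)) ?leq_addr //=.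
rewrite [X in _ + X]big_nat_cond [X in _ + X]big1 ?addn0 => [|i]; last first.
  by rewrite andbT => /andP[le_ki _]; have := @pos_leq _ _ le_ki; lia.
rewrite (eq_big_nat _ _ (F2 := fun=> 2)) ?sum_nat_const_nat ?subn0 1?mulnC //.
by move=> i /andP[_]; rewrite ltnS => /pos_leq; lia.
Qed.

(** At least one regular node precedes an even leaf of positive rank, so the plateau of [L] below it
    contains three consecutive arguments. *)
Lemma L_below_double j n :
  pos j.*2.+2 <= n + 2 -> n <= pos j.*2.+2 -> L n = 4 * j.+1.
Proof.
move=> ge_n le_n; rewrite (@L_between j.*2.+1) //; first lia.
by move: ge_n; rewrite posS -doubleS logn2_double; lia.
Qed.

(** A new label fills at most one new cell and empties none; truncated subtraction covers both
    orders of [m] and [n]. *)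
Lemma L_lipschitz m n : L m <= L n + (m - n).
Proof.
have L_addr k d : L (k + d) <= L k + d.
  rewrite /L /nonempty_cells iotaD pmap_cat undup_cat size_cat leq_add //.
    by rewrite size_filter count_size.
  apply: leq_trans (size_undup _) _.
  by rewrite size_pmap (leq_trans (count_size _ _)) // size_iota.
have L_mono k d : L k <= L (k + d).
  rewrite /L uniq_leq_size ?nonempty_cells_uniq // => c.
  by rewrite !nonempty_cell => /andP[-> /ltn_addr->].
have [le_mn|/ltnW le_nm] := leqP m n.
  by rewrite -(subnKC le_mn) (leq_trans (L_mono m (n - m))) ?leq_addr.
by rewrite -{1}(subnKC le_nm) L_addr.
Qed.

Lemma pos_double_lt (b : bool) n j :
  (pos j.*2 + b < n) = (pos j + b < n - L (n - 2)).
Proof.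
case: j => [|j].
  rewrite double0 /pos; have := L_lipschitz (n - 2) 0.
  by have : L 0 = 0 by []; case: b; lia.
rewrite doubleS.
have := pos_double j.+1; rewrite doubleS => pos_2j.
have pos_gt : pos j.*2 + 6 <= pos j.*2.+2.
  by have := pos_leq j.*2 j.*2.+2; lia.
(* [L (n - 2)] is compared with the plateau value [4 * j.+1], taken at the threshold minus 1 or
   minus 2; for either [b] these points stay on the plateau. *)
have [lt_n|ge_n] := ltnP (pos j.*2.+2 + b) n.
  have := @L_below_double j (pos j.*2.+2 + b - 1).
  have := L_lipschitz (n - 2) (pos j.*2.+2 + b - 1); case: b lt_n; lia.
have := @L_below_double j (pos j.*2.+2 + b - 2).
have := L_lipschitz (pos j.*2.+2 + b - 2) (n - 2); case: b ge_n; lia.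
Qed.

Lemma L_leftE n : L_left n = L (n - L (n - 2)).
Proof.
rewrite (@L_left_sum n n) // (@L_sum _ n) ?leq_subr //.
apply: eq_bigr => j _; have := pos_double_lt false n j.
by rewrite !addn0 => ->; rewrite (pos_double_lt true).
Qed.

Theorem theorem3p3 (n : nat) (hn : 6 <= n) :
  [/\ L_left n = L (n - L (n - 2)),
      L_right n = L (n - 3 - L (n - 5)) &
      L n = L (n - L (n - 2)) + L (n - 3 - L (n - 5))].
Proof.
have -> : n - 5 = n - 3 - 2 by rewrite -subnDA.
by rewrite -!L_leftE -L_right_left; split=> //; apply: L_split.
Qed.
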